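(* The eigenfunctions of the equation $$(x-r)\big(a_2x^2+a_1x+a_0\big)y_n''(x)+\big(b_2x^2+b_1x+b_0\big)y_n'(x)-\Big(n\big(b_2+(n-1)a_2\big)(x-r)+c_0^*\Big)y_n(x)=0,\qquad n\ge1,$$ where $(-1)^{\theta}=1$ with $$\theta=\frac{b_2r^2+b_1r+b_0}{a_2r^2+a_1r+a_0},$$ are exceptional $X_1$-polynomials orthogonal with respect to the weight function $$\rho(x)=(x-r)^{\theta}\exp\left(\int\frac{\big(b_2-a_2(2+\theta)\big)x+b_1+b_2r-\theta(a_1+a_2r)-a_1}{a_2x^2+a_1x+a_0}\,dx\right).$$
   Context: Here $a_0,a_1,a_2,b_0,b_1,b_2,r$ are real parameters such that $a_2r^2+a_1r+a_0\ne0$ and the roots of $b_2x^2+b_1x+b_0$ are real. The constant $c_0^*$, together with a real constant $\nu$, satisfies $$2b_2r+b_1-c_0^*+\nu b_2=0,\qquad b_2r^2+b_1r+b_0+\nu c_0^*=0.$$ Thus, when $b_2\ne0$ and $b_2x^2+b_1x+b_0=b_2(x-r_1)(x-r_2)$, either $\nu=r_1-r$ and $c_0^*=b_2(r-r_2)$, or $\nu=r_2-r$ and $c_0^*=b_2(r-r_1)$. The eigenfunctions considered are the polynomial solutions $y_n$ of degree $n$, $n\ge1$ (so the sequence starts in degree $1$), in the space $\Pi_{n,r,\nu}=\mathrm{span}\{x-r-\nu,(x-r)^2,\dots,(x-r)^n\}$. The corresponding eigenvalue is $\lambda_n=n\big(b_2+(n-1)a_2\big)$. Orthogonality is on an interval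 $[a,b]$ and means $$\int_a^b\rho(x)\,y_n(x)\,y_m(x)\,dx=0\qquad(m\ne n).$$ With $\omega(x)=\rho(x)/(x-r)$, the interval is such that $$\omega(a)(a-r)(a_2a^2+a_1a+a_0)=0,\qquad \omega(b)(b-r)(a_2b^2+a_1b+a_0)=0.$$ *)

(* Defs.v *)
From HB Require Import structures.
From mathcomp Require Import all_boot all_order all_algebra.
From mathcomp Require Import all_classical all_reals all_analysis.
From mathcomp Require Import complex.

Set Implicit Arguments.
Unset Strict Implicit.
Unset Printing Implicit Defensive.

Import Order.TTheory GRing.Theory Num.Theory.
Import numFieldNormedType.Exports.

Local Open Scope classical_set_scope.
Local Open Scope ring_scope.

Definition quad (R : realType) (u2 u1 u0 : R) : {poly R} :=
  u2 *: 'X^2 + u1 *: 'X + u0%:P.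

(* The zero polynomial, which has no well-defined roots, is not constrained. *)
Definition real_roots (R : realType) (p : {poly R}) : Prop :=
  p != 0 ->
  forall z : R[i], root (map_poly (real_complex R) p) z -> z \is Num.real.

Definition eigenvalue (R : realType) (a2 b2 : R) (n : nat) : R :=
  n%:R * (b2 + (n%:R - 1) * a2).

(* p lies in span {x - r - nu, (x - r)^2, ..., (x - r)^n}; meant for n >= 1. *)
Definition in_Pi (R : realType) (n : nat) (r nu : R) (p : {poly R}) : Prop :=
  exists e : nat -> R,
    p = e 1%N *: ('X - (r + nu)%:P)
        + \sum_(2 <= k < n.+1) e k *: ('X - r%:P) ^+ k.

Definition solves_ode (R : realType) (a2 a1 a0 b2 b1 b0 r c : R) (n : nat)
    (p : {poly R}) : Prop :=
  ('X - r%:P) * quad a2 a1 a0 * p^`(2) + quad b2 b1 b0 * p^`()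
  - (eigenvalue a2 b2 n *: ('X - r%:P) + c%:P) * p = 0.

(* Only the values y n with n >= 1 are used. *)
Definition eigenfunctions (R : realType) (a2 a1 a0 b2 b1 b0 r c nu : R)
    (y : nat -> {poly R}) : Prop :=
  forall n : nat, (0 < n)%N ->
    [/\ size (y n) = n.+1, in_Pi n r nu (y n)
      & solves_ode a2 a1 a0 b2 b1 b0 r c n (y n)].

(* X_1: the degrees are 1, 2, 3, ... (degree 0 is missing), and the first n
   members span the n-dimensional space Pi_{n,r,nu}, of codimension 1 among
   the polynomials of degree at most n. *)
Definition exceptional_X1 (R : realType) (r nu : R) (y : nat -> {poly R}) :
    Prop :=
  forall n : nat, (0 < n)%N ->
    size (y n) = n.+1 /\
    forall p : {poly R}, in_Pi n r nu p <->
      exists e : nat -> R, p = \sum_(1 <= k < n.+1) e k *: y k.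

Definition theta (R : realType) (a2 a1 a0 b2 b1 b0 r : R) : R :=
  (quad b2 b1 b0).[r] / (quad a2 a1 a0).[r].

(* The endpoints may be infinite. The interval is open because rho need not
   extend to the endpoints; this does not affect the integrals over [a, b]. *)
Definition oitv (R : realType) (a b : \bar R) : set R :=
  [set x : R | (a < x%:E)%E /\ (x%:E < b)%E].

(* Approach to the endpoints from inside; the third case of each match is
   excluded by a < b. *)
Definition to_left_end (R : realType) (a : \bar R) : set_system R :=
  match a with
  | x%:E => x^'+
  | -oo%E => ninfty_nbhs R
  | +oo%E => pinfty_nbhs R
  end.

Definition to_right_end (R : realType) (b : \bar R) : set_system R :=
  match b with
  | x%:E => x^'-
  | +oo%E => pinfty_nbhs R
  | -oo%E => ninfty_nbhs R
  end.

Definition exponent_integrand (R : realType) (a2 a1 a0 b2 b1 b0 r : R) (x : R) :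
    R :=
  let th := theta a2 a1 a0 b2 b1 b0 r in
  ((b2 - a2 * (2 + th)) * x + b1 + b2 * r - th * (a1 + a2 * r) - a1)
  / (quad a2 a1 a0).[x].

(* G is an indefinite integral of f on D. *)
Definition antiderivative_on (R : realType) (D : set R) (f G : R -> R) : Prop :=
  forall x : R, D x -> is_derive x (1 : R) G (f x).

(* (x - r)^theta exp (int ...), where k is the integer equal to theta and G is
   an indefinite integral of exponent_integrand. *)
Definition rho (R : realType) (r : R) (k : int) (G : R -> R) (x : R) : R :=
  (x - r) ^ k * expR (G x).

Definition omega (R : realType) (r : R) (k : int) (G : R -> R) (x : R) : R :=
  rho r k G x / (x - r).

Definition orthogonal_on (R : realType) (D : set R) (w : R -> R)
    (y : nat -> {poly R}) : Prop :=
  forall n m : nat, (0 < n)%N -> (0 < m)%N -> m <> n ->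
    (\int[@lebesgue_measure R]_(x in D) (w x * (y n).[x] * (y m).[x])%:E
     = 0)%E.

(* Main.v *)
Require Import Defs.
From HB Require Import structures.
From mathcomp Require Import all_boot all_order all_algebra.
From mathcomp Require Import all_classical all_reals all_analysis.
From mathcomp Require Import measurable_realfun ring lra.

Import Order.TTheory GRing.Theory Num.Theory.
Import numFieldNormedType.Exports.

Local Open Scope classical_set_scope.
Local Open Scope ring_scope.

(** Everything rests on the Sturm-Liouville form of the equation.  Write
    A = a2 x^2 + a1 x + a0, B = b2 x^2 + b1 x + b0, t = x - r and
    D y = t A y'' + B y' - c y, so that the equation reads D y = lambda_n t y.

    The space Pi_n is the set of polynomials of degree at most n killed by the
    linear form p |-> p(r) + nu p'(r) ([in_PiE]).  It has dimension n, so the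
    polynomials y_1, ..., y_n, which lie in it and have distinct degrees, form
    a basis of it ([Pi_form_span]).  This is the claim about exceptional
    polynomials.

    It also forces theta = -2.  Each y_n satisfies D y_n = t (lambda_n y_n),
    and these polynomials span the whole kernel of the form, so D p = t q with
    q again in the kernel, for all p in the kernel.  Taking p = t^2 and p = t^3
    gives nu != 0 and B(r) = -2 A(r) ([coef_ratio_at_singularity]).  Hence
    rho = t^-2 exp G, which is positive away from r.  Moreover r is not in the
    interval: t - nu is in the kernel and does not vanish at r, so
    rho (t - nu)^2 would have a double pole there and could not be integrable
    ([double_pole_not_integrable]).

    Let W = y_n' y_m - y_n y_m'.  The choice of rho gives (rho A)' = rho B / t,
    whence (rho A W)' = (lambda_n - lambda_m) rho y_n y_m on the interval.  The
    function rho A W takes arbitrarily small values near both endpoints.  At a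
    finite endpoint this is the boundary condition, as W is bounded there.  At
    an infinite endpoint the boundary condition does not control the growing
    factor W, but t^4 rho A W = rho (t^2 A W) t^2 is integrable, both factors
    t^2 A W and t^2 being in the kernel of the form; so rho A W cannot stay
    away from 0.  By the fundamental theorem of calculus and dominated
    convergence, (lambda_n - lambda_m) times the integral of rho y_n y_m is 0
    ([integral_derivative_eq0]).

    If lambda_n != lambda_m this is orthogonality.  If lambda_n = lambda_m, then
    rho A W is constant, hence 0, so W = 0 on the interval; but W is a nonzero
    polynomial when the degrees of y_n and y_m differ ([wronskian_neq0]).  So
    eigenvalues of distinct eigenfunctions never coincide here. *)

(** * Polynomials with a Robin condition at r *)

Lemma deriv1 {R : realType} : (1 : {poly R})^`() = 0.
Proof. exact: derivC. Qed.

(** Ordered so that 'X - a%:P is differentiated as a whole. *)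
Definition derivEs :=
  (derivXsubC, derivX, deriv0, @deriv1, derivC, derivZ, derivM, derivB, derivD).

(** The linear form whose kernel is the union of the spaces Pi_{n,r,nu}. *)
Definition Pi_form {R : realType} (r nu : R) (p : {poly R}) : R :=
  p.[r] + nu * p^`().[r].

Lemma Pi_formD {R : realType} (r nu : R) (p q : {poly R}) :
  Pi_form r nu (p + q) = Pi_form r nu p + Pi_form r nu q.
Proof. by rewrite /Pi_form derivD !hornerD; ring. Qed.

Lemma Pi_formZ {R : realType} (r nu e : R) (p : {poly R}) :
  Pi_form r nu (e *: p) = e * Pi_form r nu p.
Proof. by rewrite /Pi_form derivZ !hornerZ; ring. Qed.

Lemma Pi_form_multiple {R : realType} (r nu : R) (p : {poly R}) :
  Pi_form r nu (('X - r%:P) ^+ 2 * p) = 0.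
Proof. by rewrite /Pi_form expr2 !derivEs !hornerE /=; ring. Qed.

(** In powers of x - r, the first two coefficients s0 and s1 of p are p(r) and
    p'(r); the basis element x - r - nu encodes exactly s0 = - nu s1. *)
Lemma in_PiE {R : realType} (n : nat) (r nu : R) (p : {poly R}) :
  (0 < n)%N -> in_Pi n r nu p <-> (size p <= n.+1)%N /\ Pi_form r nu p = 0.
Proof.
move=> n0; split=> [[e ->]|[sp hp]].
  split.
    apply: (leq_trans (size_polyD _ _)); rewrite geq_max; apply/andP; split.
      apply: (leq_trans (size_scale_leq _ _)).
      by rewrite size_XsubC ltnS.
    apply: (leq_trans (size_sum _ _ _)); apply/bigmax_leqP_seq => i.
    rewrite mem_index_iota => /andP[_ ilt] _.
    apply: (leq_trans (size_scale_leq _ _)).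
    by rewrite size_exp_XsubC.
  rewrite Pi_formD Pi_formZ big_nat.
  have -> : Pi_form r nu ('X - (r + nu)%:P) = 0.
    by rewrite /Pi_form !derivEs !hornerE /=; ring.
  rewrite mulr0 add0r.
  apply: (big_ind (fun p => Pi_form r nu p = 0)).
  - by rewrite /Pi_form deriv0 !horner0 mulr0 addr0.
  - by move=> u v hu hv; rewrite Pi_formD hu hv addr0.
  - move=> i /andP[/subnKC <- _]; rewrite exprD Pi_formZ.
    by rewrite Pi_form_multiple mulr0.
pose s := p \Po ('X + r%:P).
have ps : p = s \Po ('X - r%:P).
  by rewrite -comp_polyA comp_polyD comp_polyX comp_polyC subrK comp_polyXr.
have ss : (size s <= n.+1)%N by rewrite size_comp_poly2 ?size_XaddC.
have pE : p = \sum_(0 <= k < n.+1) s`_k *: ('X - r%:P) ^+ k.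
  rewrite {1}ps comp_polyE big_mkord (big_ord_widen _ (fun i =>
    s`_i *: ('X - r%:P) ^+ i) ss) big_mkcond /=.
  apply: eq_bigr => i _; case: ltnP => // hi.
  by rewrite nth_default ?scale0r.
exists (fun k => s`_k).
have s0 : s`_0 = - (nu * s`_1).
  have e0 : p.[r] = s`_0.
    by rewrite ps horner_comp !hornerE subrr horner_coef0.
  have e1 : p^`().[r] = s`_1.
    rewrite ps deriv_comp !derivEs mulr1 horner_comp !hornerE subrr.
    by rewrite horner_coef0 coef_deriv.
  by move: hp; rewrite /Pi_form e0 e1 => /eqP; rewrite addr_eq0 => /eqP.
rewrite {1}pE big_ltn // big_ltn //= addrA; congr (_ + _).
rewrite expr0 expr1 s0 -!mul_polyC !(polyCN, polyCM, polyCD); ring.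
Qed.

(** The leading coefficient of p can be cancelled by a multiple of the y of the
    same degree, and a constant killed by the form is 0; so induction on the
    degree writes p over the y_k without using y_0. *)
Lemma Pi_form_span {R : realType} (r nu : R) (y : nat -> {poly R})
    (hy : forall n, (0 < n)%N -> size (y n) = n.+1 /\ Pi_form r nu (y n) = 0)
    (n : nat) (p : {poly R}) :
  (size p <= n.+1)%N -> Pi_form r nu p = 0 ->
  exists e : nat -> R, p = \sum_(1 <= k < n.+1) e k *: y k.
Proof.
elim: n p => [|n IH] p sp hp.
  exists (fun=> 0); rewrite big_geq //.
  move: hp; rewrite (size1_polyC sp) /Pi_form derivC !hornerC mulr0 addr0.
  by move=> ->.
have [sy hyn] := hy n.+1 isT.
have ly : (y n.+1)`_n.+1 != 0.
  by have := lead_coef_eq0 (y n.+1); rewrite lead_coefE sy => ->;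
     rewrite -size_poly_eq0 sy.
pose d := p`_n.+1 / (y n.+1)`_n.+1.
have [||e he] := IH (p - d *: y n.+1).
- apply/leq_sizeP => j; rewrite leq_eqVlt => /orP[/eqP <-|nj].
    by rewrite coefB coefZ mulfVK ?subrr.
  rewrite coefB coefZ !nth_default ?mulr0 ?subr0 ?sy //.
  exact: leq_trans sp nj.
- by rewrite -scaleNr Pi_formD Pi_formZ hp hyn mulr0 addr0.
exists (fun k => if k == n.+1 then d else e k).
rewrite big_nat_recr //= eqxx -[LHS](subrK (d *: y n.+1)) he; congr (_ + _).
by apply: eq_big_nat => i /andP[_ hi]; rewrite ltn_eqF.
Qed.

Lemma exceptional_of_Pi_form {R : realType} (r nu : R) (y : nat -> {poly R}) :
  (forall n, (0 < n)%N -> size (y n) = n.+1 /\ Pi_form r nu (y n) = 0) ->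
  exceptional_X1 r nu y.
Proof.
move=> hy n n0; split; first by have [] := hy n n0.
move=> p; rewrite in_PiE //; split=> [[sp hp]|[e ->]].
  exact: (Pi_form_span _ _ _ hy).
rewrite big_nat; split.
  apply: (leq_trans (size_sum _ _ _)).
  apply/bigmax_leqP_seq => i _ /andP[i0 ilt].
  by apply: (leq_trans (size_scale_leq _ _)); have [-> _] := hy i i0.
apply: (big_ind (fun p => Pi_form r nu p = 0)).
- by rewrite /Pi_form deriv0 !horner0 mulr0 addr0.
- by move=> u v hu hv; rewrite Pi_formD hu hv addr0.
- by move=> i /andP[i0 _]; rewrite Pi_formZ (proj2 (hy i i0)) mulr0.
Qed.

(** * The equation forces theta = -2 *)

(** The equation for y with eigenvalue l reads ode_op y = l (x - r) y. *)
Definition ode_op {R : realType} (A B : {poly R}) (r c : R) (p : {poly R}) :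
    {poly R} :=
  ('X - r%:P) * A * p^`(2) + B * p^`() - c *: p.

(** If ode_op p = (x - r) q, this is 2 (q(r) + nu q'(r)), as [quotient_formE]
    shows.  Written with derivatives of ode_op p it is linear in p and avoids
    the division by x - r. *)
Definition quotient_form {R : realType} (A B : {poly R}) (r c nu : R)
    (p : {poly R}) : R :=
  2 * (ode_op A B r c p)^`().[r] + nu * (ode_op A B r c p)^`(2).[r].

Lemma quotient_formD {R : realType} (A B : {poly R}) (r c nu : R)
    (p q : {poly R}) :
  quotient_form A B r c nu (p + q) =
  quotient_form A B r c nu p + quotient_form A B r c nu q.
Proof.
rewrite /quotient_form.
have -> : ode_op A B r c (p + q) = ode_op A B r c p + ode_op A B r c q.
  by rewrite /ode_op derivnD derivD scalerDr; ring.
by rewrite !(derivnD, derivD) !hornerE /=; ring.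
Qed.

Lemma quotient_formZ {R : realType} (A B : {poly R}) (r c nu e : R)
    (p : {poly R}) :
  quotient_form A B r c nu (e *: p) = e * quotient_form A B r c nu p.
Proof.
rewrite /quotient_form.
have -> : ode_op A B r c (e *: p) = e *: ode_op A B r c p.
  by rewrite /ode_op derivnZ derivZ -!mul_polyC; ring.
by rewrite !(derivnZ, derivZ) !hornerE /=; ring.
Qed.

Lemma quotient_formE {R : realType} (A B : {poly R}) (r c nu : R)
    (p q : {poly R}) :
  ode_op A B r c p = ('X - r%:P) * q ->
  quotient_form A B r c nu p = 2 * Pi_form r nu q.
Proof.
move=> hD; rewrite /quotient_form hD derivnS derivn1 /Pi_form.
rewrite !derivEs !hornerE /=; ring.
Qed.

Lemma quotient_form_square {R : realType} (A B : {poly R}) (r c nu : R) :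
  quotient_form A B r c nu (('X - r%:P) ^+ 2) =
  2 * (2 * (A.[r] + B.[r]) + nu * (2 * (A^`().[r] + B^`().[r]) - c)).
Proof.
rewrite (quotient_formE _ _ _ _ _ _ (2 *: (A + B) - c *: ('X - r%:P))).
  rewrite /Pi_form !derivEs !hornerE /=; ring.
rewrite /ode_op !derivnS !derivn0 expr2 !derivEs -!mul_polyC; ring.
Qed.

Lemma quotient_form_cube {R : realType} (A B : {poly R}) (r c nu : R) :
  quotient_form A B r c nu (('X - r%:P) ^+ 3) = 6 * nu * (2 * A.[r] + B.[r]).
Proof.
rewrite (quotient_formE _ _ _ _ _ _
  (('X - r%:P) * (6 *: A + 3 *: B - c *: ('X - r%:P)))).
  rewrite /Pi_form !derivEs !hornerE /=; ring.
rewrite /ode_op !derivnS !derivn0 exprS expr2 !derivEs -!mul_polyC; ring.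
Qed.

(** The form vanishes on the y_n, which are mapped to multiples of
    (x - r) y_n, hence on everything they span, in particular on (x - r)^2 and
    (x - r)^3. *)
Lemma coef_ratio_at_singularity {R : realType} (A B : {poly R}) (r c nu : R)
    (l : nat -> R) (y : nat -> {poly R}) :
  A.[r] != 0 -> B.[r] + nu * c = 0 ->
  (forall n, (0 < n)%N -> size (y n) = n.+1 /\ Pi_form r nu (y n) = 0) ->
  (forall n, (0 < n)%N ->
     ode_op A B r c (y n) = l n *: (('X - r%:P) * y n)) ->
  nu != 0 /\ B.[r] = - 2 * A.[r].
Proof.
move=> hA hc hy hode.
have Q0 p : Pi_form r nu p = 0 -> quotient_form A B r c nu p = 0.
  move=> hp; have [|e ->] := Pi_form_span r nu y hy (size p) p _ hp => //.
  rewrite big_nat.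
  apply: (big_ind (fun p => quotient_form A B r c nu p = 0)).
  - by rewrite -(scale0r 0) quotient_formZ mul0r.
  - by move=> u v hu hv; rewrite quotient_formD hu hv addr0.
  - move=> i /andP[i0 _]; rewrite quotient_formZ.
    rewrite (quotient_formE _ _ _ _ _ _ (l i *: y i)).
      by rewrite Pi_formZ (proj2 (hy i i0)) !mulr0.
    by rewrite hode // scalerAr.
have /Q0 := Pi_form_multiple r nu 1; rewrite mulr1 quotient_form_square => e2.
have /Q0 := Pi_form_multiple r nu ('X - r%:P).
rewrite -exprSr quotient_form_cube => e3.
have nu0 : nu != 0.
  apply: contraNneq hA => nu0; move: e2 hc.
  rewrite nu0 !mul0r !addr0 => e2 hB; move: e2; rewrite hB addr0 => e2.
  by apply/eqP; lra.
split=> //; have /eqP : 6 * nu * (2 * A.[r] + B.[r]) = 0 := e3.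
rewrite !mulf_eq0 (negbTE nu0) orbF pnatr_eq0 /= => /eqP; lra.
Qed.

(** * Integration of a derivative over an open interval *)

Lemma oitv_nonempty {R : realType} (a b : \bar R) :
  (a < b)%E -> exists x, oitv a b x.
Proof.
case: a b => [a||] [b||] //; rewrite ?lte_fin => ab.
- by exists ((a + b) / 2); rewrite /oitv /= !lte_fin; split; lra.
- by exists (a + 1); rewrite /oitv /= lte_fin ltry; split => //; lra.
- by exists (b - 1); rewrite /oitv /= lte_fin ltNyr; split => //; lra.
- by exists 0; rewrite /oitv /= ltry ltNyr.
Qed.

Lemma oitv_convex {R : realType} (a b : \bar R) (u v x : R) :
  oitv a b u -> oitv a b v -> u <= x <= v -> oitv a b x.
Proof.
move=> [au _] [_ vb] /andP[ux xv]; split.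
  by apply: lt_le_trans au _; rewrite lee_fin.
by apply: le_lt_trans vb; rewrite lee_fin.
Qed.

Lemma oitv_open {R : realType} (a b : \bar R) : open (oitv a b).
Proof.
rewrite (_ : oitv a b = [set x | (a < x%:E)%E] `&` [set x | (x%:E < b)%E]) //.
by apply: openI; [exact: open_ereal_gt | exact: open_ereal_lt].
Qed.

Lemma oitv_measurable {R : realType} (a b : \bar R) : measurable (oitv a b).
Proof. by apply: open_measurable; exact: oitv_open. Qed.

Lemma oitvN {R : realType} (a b : \bar R) (x : R) :
  oitv a b x -> oitv (- b)%E (- a)%E (- x).
Proof. by move=> [? ?]; split; rewrite EFinN lteN2. Qed.

(** Sequences treat finite and infinite endpoints alike. *)
Lemma oitv_cofinal {R : realType} (a b : \bar R) (x0 : R) :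
  oitv a b x0 ->
  exists d : nat -> R, (forall n, oitv a b (d n) /\ x0 <= d n) /\
    forall x, oitv a b x -> \forall n \near \oo, x <= d n.
Proof.
move=> [ax0 x0b].
have ad z : x0 <= z -> (a < z%:E)%E.
  by move=> ?; apply: lt_le_trans ax0 _; rewrite lee_fin.
case: b x0b => [b||] //= x0b.
- exists (fun n => Num.max x0 (b - n.+1%:R^-1)); split=> [n|x [_]].
    have x0m : x0 <= Num.max x0 (b - n.+1%:R^-1) by rewrite le_max lexx.
    split=> //; split; first exact: ad.
    by move: x0b; rewrite !lte_fin gt_max => -> /=; rewrite ltrBlDr ltrDl.
  rewrite lte_fin => xb.
  have xb0 : 0 < b - x by rewrite subr_gt0.
  have := near_infty_natSinv_lt (PosNum xb0); apply: filterS => n /= hn.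
  by rewrite le_max lerBrDr -lerBrDl (ltW hn) orbT.
- exists (fun n => Num.max x0 n%:R); split=> [n|x _].
    have x0m : x0 <= Num.max x0 n%:R by rewrite le_max lexx.
    by split=> //; split; [exact: ad | rewrite ltry].
  have := nbhs_infty_ger x; apply: filterS => n /= hn.
  by rewrite le_max hn orbT.
Qed.

Lemma oitv_coinitial {R : realType} (a b : \bar R) (x0 : R) :
  oitv a b x0 ->
  exists d : nat -> R, (forall n, oitv a b (d n) /\ d n <= x0) /\
    forall x, oitv a b x -> \forall n \near \oo, d n <= x.
Proof.
move=> /oitvN /oitv_cofinal [d [hd hlim]]; exists (fun n => - d n); split.
  move=> n; have [/oitvN] := hd n; rewrite !oppeK => ? ?.
  by split=> //; rewrite lerNl.
by move=> x /oitvN /hlim; apply: filterS => n; rewrite lerNl.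
Qed.

(** The area of a rectangle below the graph of |f| is at most the integral
    of |f|.  So rectangles of unbounded area refute integrability. *)
Lemma integrable_box_bounded {R : realType} (D : set R) (f : R -> R) :
  measurable D -> (@lebesgue_measure R).-integrable D (EFin \o f) ->
  exists K : R, forall u v e : R, u < v -> 0 <= e ->
    (forall x, u <= x <= v -> D x /\ e <= `|f x|) -> e * (v - u) <= K.
Proof.
move=> mD /integrableP[mf finf].
exists (fine (\int[@lebesgue_measure R]_(x in D) `|(EFin \o f) x|)%E) =>
  u v e uv e0 huv.
have sub : `[u, v] `<=` D.
  by move=> x /=; rewrite in_itv /= => /huv[].
rewrite -lee_fin fineK; last first.
  by rewrite ge0_fin_numE // integral_ge0.
have mabs : measurable_fun D (fun x => `|(EFin \o f) x|)%E.
  exact: measurableT_comp.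
apply: (@le_trans _ _
  (\int[@lebesgue_measure R]_(x in `[u, v]) `|(EFin \o f) x|)%E); last first.
  exact: ge0_subset_integral.
have -> : (e * (v - u))%:E =
    (\int[@lebesgue_measure R]_(x in `[u, v]) cst e%:E x)%E.
  by rewrite integral_cst //= lebesgue_measure_itv /= lte_fin uv EFinM.
apply: ge0_le_integral => //.
- exact: measurable_funS mabs.
- by move=> x /=; rewrite in_itv /= => /huv[_]; rewrite lee_fin.
Qed.

(** The smallness hypotheses give sequences u_n and v_n that tend to the
    endpoints and along which F tends to 0.  The integral of f over [u_n, v_n]
    is F(v_n) - F(u_n), and these integrals converge to the full one by
    domination by |f|. *)
Lemma integral_derivative_eq0 {R : realType} (a b : \bar R) (F f : R -> R) :
  (a < b)%E ->
  (forall x, oitv a b x -> is_derive x (1 : R) F (f x)) ->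
  (forall x, oitv a b x -> {for x, continuous f}) ->
  (@lebesgue_measure R).-integrable (oitv a b) (EFin \o f) ->
  (forall e x : R, 0 < e -> oitv a b x ->
     exists z, [/\ oitv a b z, x < z & `|F z| < e]) ->
  (forall e x : R, 0 < e -> oitv a b x ->
     exists z, [/\ oitv a b z, z < x & `|F z| < e]) ->
  (\int[@lebesgue_measure R]_(x in oitv a b) (f x)%:E = 0)%E.
Proof.
move=> /oitv_nonempty[x0 hx0] dF cf intf smallr smalll.
(* c_n and d_n tend to the endpoints; u_n < c_n <= x0 <= d_n < v_n. *)
have [d [hd hlimd]] := oitv_cofinal _ _ _ hx0.
have [c [hc hlimc]] := oitv_coinitial _ _ _ hx0.
have pos n : 0 < n.+1%:R^-1 :> R by rewrite invr_gt0.
have [v hv] := choice (fun n => smallr _ _ (pos n) (proj1 (hd n))).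
have [u hu] := choice (fun n => smalll _ _ (pos n) (proj1 (hc n))).
have Fseq0 w : (forall n, `|F (w n)| < n.+1%:R^-1) ->
    F (w n) @[n --> \oo] --> 0.
  move=> hw; apply/cvgr0Pnorm_lt => e e0.
  have := near_infty_natSinv_lt (PosNum e0); apply: filterS => n /= hn.
  exact: lt_trans (hw n) hn.
have Fv0 : F (v n) @[n --> \oo] --> 0 by apply: Fseq0 => n; have [] := hv n.
have Fu0 : F (u n) @[n --> \oo] --> 0 by apply: Fseq0 => n; have [] := hu n.
have uv n : u n < v n.
  have [_ xd] := hd n; have [_ cx] := hc n.
  have [_ dv _] := hv n; have [_ uc _] := hu n; lra.
have sub n : `[u n, v n] `<=` oitv a b.
  move=> x /=; rewrite in_itv /= => hx.
  by apply: oitv_convex hx; [case: (hu n) | case: (hv n)].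
have Fc x : oitv a b x -> {for x, continuous F}.
  move=> /dF[dx _]; apply/differentiable_continuous.
  exact/derivable1_diffP.
have ftc n : (\int[@lebesgue_measure R]_(x in oitv a b)
    ((EFin \o f) \_ `[u n, v n]) x = (F (v n) - F (u n))%:E)%E.
  rewrite -integral_mkcondr (setIidr (sub n)) EFinB.
  have inD x : x \in `[u n, v n] -> oitv a b x by move/sub.
  have [hun _ _] := hu n; have [hvn _ _] := hv n.
  apply: continuous_FTC2 => //.
  - apply/continuous_in_subspaceT => x; rewrite inE => /inD; exact: cf.
  - split=> [x /subset_itv_oo_cc/inD /dF[] //||].
    + exact/cvg_at_right_filter/Fc.
    + exact/cvg_at_left_filter/Fc.
  - move=> x /subset_itv_oo_cc/inD /dF dx.
    by rewrite derive1E; exact: derive_val.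
have mD := oitv_measurable a b.
have /integrableP[mf _] := intf.
have mfn n : measurable_fun (oitv a b) ((EFin \o f) \_ `[u n, v n]).
  have h : measurable_fun (oitv a b `&` `[u n, v n]) (EFin \o f).
    by apply: measurable_funS mf => // x [].
  apply: (iffLR (measurable_restrict _ _ _)) h => //.
have [|||_ _ lim] := @dominated_convergence _ _ _ (@lebesgue_measure R) _ mD
  (fun n => (EFin \o f) \_ `[u n, v n]) (EFin \o f) (abse \o (EFin \o f))
  mfn mf.
- apply: aeW => x Dx; apply: cvg_near_cst.
  apply: (filterS _ (filterI (hlimd x Dx) (hlimc x Dx))) => n [xd cx].
  rewrite patchE mem_set //= in_itv /=.
  have [_ dv _] := hv n; have [_ uc _] := hu n.
  by apply/andP; split; lra.
- exact: integrable_abse.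
- apply: aeW => x n _; rewrite patchE /=.
  by case: ifP => // _; rewrite abse0 ?lee_fin.
have lim0 : (\int[@lebesgue_measure R]_(x in oitv a b)
    ((EFin \o f) \_ `[u n, v n]) x)%E @[n --> \oo] --> 0%E.
  under eq_fun do rewrite ftc.
  apply: cvg_EFin; first exact: nearW.
  by rewrite -[X in _ --> X](subr0 0); exact: cvgB.
exact: (cvg_unique _ lim lim0).
Qed.

Lemma zero_derivative_small_eq0 {R : realType} (a b : \bar R) (F : R -> R) :
  (forall x, oitv a b x -> is_derive x (1 : R) F 0) ->
  (forall e x : R, 0 < e -> oitv a b x ->
     exists z, [/\ oitv a b z, x < z & `|F z| < e]) ->
  forall x, oitv a b x -> F x = 0.
Proof.
move=> dF smallr x Dx.
have Fcst z : oitv a b z -> x < z -> F z = F x.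
  move=> Dz xz; apply/eqP; rewrite -subr_eq0.
  have Dt t : x <= t <= z -> oitv a b t by exact: oitv_convex.
  have [t||t _ ->] := @MVT _ F (cst 0) x z xz.
  - by move=> /subset_itv_oo_cc; rewrite in_itv /= => /Dt /dF.
  - apply/continuous_in_subspaceT => t; rewrite inE /= in_itv /=.
    move=> /Dt/dF[dFt _].
    exact/differentiable_continuous/derivable1_diffP.
  - by rewrite mul0r.
apply/eqP/negPn/negP; rewrite -normr_gt0 => Fx0.
have [z [Dz xz]] := smallr _ _ Fx0 Dx.
by rewrite (Fcst z) // ltxx.
Qed.

(** * Wronskians of eigenfunctions *)

Definition wronskian {R : realType} (p q : {poly R}) : {poly R} :=
  p^`() * q - p * q^`().

Lemma lead_coef_derivE {R : realType} (p : {poly R}) :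
  lead_coef p^`() = lead_coef p * (size p).-1%:R.
Proof.
rewrite !lead_coefE polyorder.size_deriv coef_deriv mulr_natr.
case sp: (size p) => [|[|n]] //=.
all: by rewrite [p`_1]nth_default ?sp // mul0rn.
Qed.

(** The leading coefficients of the two products are in the ratio
    deg p : deg q, so the products differ. *)
Lemma wronskian_neq0 {R : realType} (p q : {poly R}) :
  p != 0 -> q != 0 -> size p <> size q -> wronskian p q != 0.
Proof.
move=> p0 q0 spq; apply/negP; rewrite subr_eq0 => /eqP/(congr1 lead_coef).
have lp0 : lead_coef p != 0 by rewrite lead_coef_eq0.
have lq0 : lead_coef q != 0 by rewrite lead_coef_eq0.
rewrite !lead_coefM !lead_coef_derivE mulrAC mulrA.
move=> /(mulfI (mulf_neq0 lp0 lq0))/eqP.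
rewrite eqr_nat => /eqP epq; apply: spq.
by rewrite (polySpred p0) epq -polySpred.
Qed.

(** In q D p - p D q, with D = ode_op, the terms in c cancel and the other ones
    combine to B W + (x - r) A W'. *)
Lemma wronskian_eigen {R : realType} (A B : {poly R}) (r c l1 l2 : R)
    (p q : {poly R}) :
  ode_op A B r c p = l1 *: (('X - r%:P) * p) ->
  ode_op A B r c q = l2 *: (('X - r%:P) * q) ->
  B * wronskian p q + ('X - r%:P) * A * (wronskian p q)^`() =
  (l1 - l2) *: (('X - r%:P) * p * q).
Proof.
move=> hp hq.
transitivity (ode_op A B r c p * q - p * ode_op A B r c q); last first.
  by rewrite hp hq -!mul_polyC polyCB; ring.
rewrite /wronskian /ode_op !derivnS !derivn0 derivB !derivM -!mul_polyC; ring.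
Qed.

Lemma wronskian_eigen_at {R : realType} (A B : {poly R}) (r c l1 l2 : R)
    (p q : {poly R}) :
  ode_op A B r c p = l1 *: (('X - r%:P) * p) ->
  ode_op A B r c q = l2 *: (('X - r%:P) * q) ->
  forall x : R,
    B.[x] * (wronskian p q).[x] + (x - r) * A.[x] * (wronskian p q)^`().[x] =
    (l1 - l2) * ((x - r) * p.[x] * q.[x]).
Proof.
move=> hp hq x.
have := congr1 (horner^~ x) (wronskian_eigen _ _ _ _ _ _ _ _ hp hq).
move: (wronskian p q) => W.
by rewrite hornerD !hornerM hornerZ !hornerM hornerXsubC.
Qed.

Lemma polynomial_eq0_on_itv {R : realType} (p : {poly R}) (u v : R) :
  u < v -> (forall x, u < x < v -> p.[x] = 0) -> p = 0.
Proof.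
move=> uv hp; apply/eqP/negPn/negP => p0.
pose z (i : nat) : R := u + (v - u) / i.+2%:R.
have uz i : u < z i < v.
  have vu : 0 < v - u by rewrite subr_gt0.
  have i0 : 0 < i.+2%:R :> R by [].
  rewrite /z ltrDl divr_gt0 //= -ltrBrDl ltr_pdivrMr //.
  by rewrite ltr_pMr // ltr1n.
have := @max_poly_roots _ p [seq z i | i <- iota 0 (size p)] p0.
rewrite size_map size_iota ltnn => h; apply/notF/h.
  by apply/allP => _ /mapP[i _ ->]; apply/rootP/hp/uz.
rewrite map_inj_uniq ?iota_uniq // => i j /addrI.
have vu0 : v - u != 0 by rewrite subr_eq0 gt_eqF.
by move=> /(mulfI vu0)/invr_inj/eqP; rewrite eqr_nat => /eqP[].
Qed.

(** * Behaviour near the endpoints and at the singular point *)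

Lemma eq_integrableR {R : realType} {D : set R} {f : R -> \bar R} {g : R -> R} :
  measurable D -> (forall x, D x -> f x = (g x)%:E) ->
  (@lebesgue_measure R).-integrable D f ->
  (@lebesgue_measure R).-integrable D (EFin \o g).
Proof.
move=> mD fg.
apply: (@eq_integrable _ _ _ (@lebesgue_measure R) D mD) => x /set_mem Dx /=.
by rewrite fg.
Qed.

Lemma integrable_lincomb {R : realType} (D : set R) (w v : R -> R)
    (y : nat -> {poly R}) (e : nat -> R) (n : nat) :
  measurable D ->
  (forall k, (0 < k)%N -> (@lebesgue_measure R).-integrable D
     (EFin \o (fun x => w x * (y k).[x] * v x))) ->
  (@lebesgue_measure R).-integrable D
     (EFin \o (fun x => w x * (\sum_(1 <= k < n.+1) e k *: y k).[x] * v x)).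
Proof.
move=> mD hy; rewrite big_nat.
apply: (big_ind (fun p : {poly R} => (@lebesgue_measure R).-integrable D
  (EFin \o (fun x => w x * p.[x] * v x)))).
- apply: eq_integrableR (integrable0 (@lebesgue_measure R) D) => // x _ /=.
  by rewrite horner0 mulr0 mul0r.
- move=> p q hp hq; have := integrableD (mu := @lebesgue_measure R) mD hp hq.
  apply: eq_integrableR => // x _ /=.
  by rewrite -EFinD hornerD mulrDr mulrDl.
- move=> i /andP[i0 _].
  have := integrableZl (mu := @lebesgue_measure R) mD (e i) (hy i i0).
  apply: eq_integrableR => // x _ /=.
  by rewrite -EFinM hornerZ; congr EFin; ring.
Qed.

(** Both p and q are combinations of the y_k, so integrability of the products
    w y_n y_m extends bilinearly; this is what makes t^2 A W available. *)
Lemma integrable_Pi {R : realType} (D : set R) (w : R -> R) (r nu : R)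
    (y : nat -> {poly R}) (p q : {poly R}) :
  measurable D ->
  (forall n, (0 < n)%N -> size (y n) = n.+1 /\ Pi_form r nu (y n) = 0) ->
  (forall n m : nat, (0 < n)%N -> (0 < m)%N ->
     (@lebesgue_measure R).-integrable D
       (EFin \o (fun x => w x * (y n).[x] * (y m).[x]))) ->
  Pi_form r nu p = 0 -> Pi_form r nu q = 0 ->
  (@lebesgue_measure R).-integrable D
    (EFin \o (fun x => w x * p.[x] * q.[x])).
Proof.
move=> mD hy hint hp hq.
have [|e ->] := Pi_form_span r nu y hy (size p) p _ hp => //.
have [|e' ->] := Pi_form_span r nu y hy (size q) q _ hq => //.
apply: integrable_lincomb => // n n0.
pose w' x := w x * (y n).[x].
have := @integrable_lincomb R D w' (fun=> 1) y e' (size q) mD.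
rewrite /w' => h; apply: eq_integrableR (h _) => // [x _ /=|m m0].
  by rewrite mulr1.
by apply: eq_integrableR (hint n m n0 m0) => // x _ /=; rewrite mulr1.
Qed.

(** At an infinite endpoint, if |P W| >= e from some point on, then so is
    (x - r)^4 |P W| once |x - r| >= 1, and long rectangles of height e have
    unbounded area. *)
Lemma small_toward_right_end {R : realType} (a b : \bar R) (r : R)
    (P W : R -> R) :
  continuous W ->
  P z @[z --> to_right_end b] --> (0 : R) ->
  (@lebesgue_measure R).-integrable (oitv a b)
    (EFin \o (fun z => (z - r) ^+ 4 * (P z * W z))) ->
  forall e x : R, 0 < e -> oitv a b x ->
    exists z, [/\ oitv a b z, x < z & `|P z * W z| < e].
Proof.
move=> cW P0 intF e x e0 Dx; have [ax xb] := Dx.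
have aD z : x < z -> (a < z%:E)%E by move=> xz; apply: lt_trans ax _.
case: b P0 intF Dx xb => [b||] //= P0 intF Dx xb.
- have PW0 : P z * W z @[z --> b^'-] --> (0 : R).
    rewrite -(mul0r (W b)); apply: cvgM => //.
    exact/cvg_at_left_filter/cW.
  have sm : \forall z \near b^'-, `|P z * W z| < e.
    exact: cvgr0_norm_lt PW0 _ e0.
  near b^'- => z.
  have zb : z < b by near: z; exact: nbhs_left_lt.
  have zx : x < z by near: z; exact: nbhs_left_gt.
  have sz : `|P z * W z| < e by near: z.
  by exists z; split=> //; split; [exact: aD | exact: zb].
- have [K hK] := integrable_box_bounded _ _ (oitv_measurable _ _) intF.
  apply: contrapT => h; pose u := Num.max x r + 1.
  have xu : x + 1 <= u by rewrite lerD2r le_max lexx.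
  have ru : r + 1 <= u by rewrite lerD2r le_max lexx orbT.
  have L0 : 0 < (`|K| + 1) / e by rewrite divr_gt0 // ltr_wpDl.
  suff : e * (u + (`|K| + 1) / e - u) <= K.
    rewrite addrAC subrr add0r mulrC divfK ?gt_eqF // leNgt => /negP; apply.
    by rewrite ltr_pwDr // ler_norm.
  apply: hK => [||z /andP[uz _]].
  + by rewrite ltrDl.
  + exact: ltW.
  + have xz : x < z by lra.
    have Dz : oitv a +oo%E z by split; [exact: aD | rewrite ltry].
    split=> //; rewrite leNgt; apply/negP => small; apply: h; exists z.
    split=> //; apply: le_lt_trans small; rewrite [leRHS]normrM ler_peMl //.
    by rewrite normrX exprn_ege1 // ler_normr; apply/orP; left; lra.
Unshelve. all: by end_near. Qed.

Lemma small_toward_left_end {R : realType} (a b : \bar R) (r : R)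
    (P W : R -> R) :
  continuous W ->
  P z @[z --> to_left_end a] --> (0 : R) ->
  (@lebesgue_measure R).-integrable (oitv a b)
    (EFin \o (fun z => (z - r) ^+ 4 * (P z * W z))) ->
  forall e x : R, 0 < e -> oitv a b x ->
    exists z, [/\ oitv a b z, z < x & `|P z * W z| < e].
Proof.
move=> cW P0 intF e x e0 Dx; have [ax xb] := Dx.
have Db z : z < x -> (z%:E < b)%E by move=> xz; apply: lt_trans xb.
case: a P0 intF Dx ax => [a||] //= P0 intF Dx ax.
- have PW0 : P z * W z @[z --> a^'+] --> (0 : R).
    rewrite -(mul0r (W a)); apply: cvgM => //.
    exact/cvg_at_right_filter/cW.
  have sm : \forall z \near a^'+, `|P z * W z| < e.
    exact: cvgr0_norm_lt PW0 _ e0.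
  near a^'+ => z.
  have zb : a < z by near: z; exact: nbhs_right_gt.
  have zx : z < x by near: z; exact: nbhs_right_lt.
  have sz : `|P z * W z| < e by near: z.
  by exists z; split=> //; split; [exact: zb | exact: Db].
- have [K hK] := integrable_box_bounded _ _ (oitv_measurable _ _) intF.
  apply: contrapT => h; pose u := Num.min x r - 1.
  have xu : u <= x - 1 by rewrite lerD2r ge_min lexx.
  have ru : u <= r - 1 by rewrite lerD2r ge_min lexx orbT.
  have L0 : 0 < (`|K| + 1) / e by rewrite divr_gt0 // ltr_wpDl.
  suff : e * (u - (u - (`|K| + 1) / e)) <= K.
    rewrite opprB addrC subrK mulrC divfK ?gt_eqF // leNgt => /negP; apply.
    by rewrite ltr_pwDr // ler_norm.
  apply: hK => [||z /andP[_ uz]].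
  + by rewrite ltrBlDr ltrDl.
  + exact: ltW.
  + have xz : z < x by lra.
    have Dz : oitv -oo%E b z by split; [rewrite ltNyr | exact: Db].
    split=> //; rewrite leNgt; apply/negP => small; apply: h; exists z.
    split=> //; apply: le_lt_trans small; rewrite [leRHS]normrM ler_peMl //.
    by rewrite normrX exprn_ege1 // ler_normr; apply/orP; right; lra.
Unshelve. all: by end_near. Qed.

(** Near r the integrand is at least a multiple of (x - r)^-2, so on
    [r + s, r + 2 s] it bounds a rectangle of area of order 1 / s. *)
Lemma double_pole_not_integrable {R : realType} (D : set R) (r : R)
    (h : R -> R) :
  open D -> measurable D -> D r -> {for r, continuous h} -> 0 < h r ->
  ~ (@lebesgue_measure R).-integrable D
      (EFin \o (fun x => (x - r) ^- 2 * h x)).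
Proof.
move=> oD mD Dr ch hr0 /(integrable_box_bounded _ _ mD) [K hK].
have hr2 : h r / 2 < h r by lra.
have nD : \forall x \near r, D x by exact: open_nbhs_nbhs (conj oD Dr).
have nh : \forall x \near r, h r / 2 < h x by exact: (cvgr_gt (h r) ch).
have /nbhs_ballP[d /= d0 hd] : \forall x \near r, D x /\ h r / 2 < h x.
  by near=> x; split; near: x.
pose M := 4 * (`|K| + 1).
have M0 : 0 < M by rewrite mulr_gt0 // ltr_wpDl.
(* d / 4 keeps [r + s, r + 2 s] in the neighbourhood where h > h r / 2; the
   other bound makes the area (h r / 2) / (4 s) at least |K| + 1. *)
pose s := Num.min (d / 4) (h r / 2 / M).
have s0 : 0 < s by rewrite lt_min !divr_gt0.
have sd : s <= d / 4 by rewrite ge_min lexx.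
have sM : s <= h r / 2 / M by rewrite ge_min lexx orbT.
have C0 : 0 <= h r / 2 / (4 * s ^+ 2) by rewrite divr_ge0 // ?mulr_ge0 //; nra.
suff : h r / 2 / (4 * s ^+ 2) * (r + 2 * s - (r + s)) <= K.
  have -> : h r / 2 / (4 * s ^+ 2) * (r + 2 * s - (r + s)) = h r / 2 / (4 * s).
    by field; rewrite gt_eqF.
  rewrite leNgt => /negP; apply; rewrite ltr_pdivlMr ?mulr_gt0 //.
  move: sM; rewrite ler_pdivlMr // /M; have := ler_norm K; nra.
apply: hK => [||x /andP[x1 x2]].
- by lra.
- exact: C0.
- have [|Dx hx] := hd x.
    by rewrite /ball /= ltr_norml; apply/andP; split; lra.
  split=> //; have q0 : 0 < (x - r) ^+ 2 by rewrite exprn_gt0; lra.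
  have hx0 : 0 < h x by lra.
  rewrite ger0_norm; last by rewrite mulr_ge0 ?invr_ge0 // ltW.
  rewrite mulrC ler_pM ?invr_ge0 ?(ltW hx) //; try lra.
    by rewrite mulr_ge0 // sqr_ge0.
  rewrite lef_pV2 ?posrE //; [nra | by rewrite mulr_gt0 // exprn_gt0].
Unshelve. all: by end_near. Qed.

(** * Orthogonality *)

(** With g the exponent integrand, the hypothesis relating A and B says that
    rho A is an integrating factor: (rho A)' = rho B / (x - r). *)
Lemma is_derive_rho {R : realType} (A B : {poly R}) (r x g : R) (G : R -> R) :
  x != r -> is_derive x (1 : R) G g ->
  (x - r) * (g * A.[x] + A^`().[x]) - 2 * A.[x] = B.[x] ->
  is_derive x (1 : R) (fun z => rho r (- 2) G z * A.[z])
    (rho r (- 2) G x * B.[x] / (x - r)).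
Proof.
move=> xr dG gAB.
have xr0 : x - r != 0 by rewrite subr_eq0.
have dt : is_derive x (1 : R) (fun z => z - r) 1.
  by apply: is_derive_eq; rewrite subr0.
have dt2 : is_derive x (1 : R) (fun z => (z - r) ^+ 2) (2 * (x - r)).
  apply: trigger_derive (is_deriveX 2 dt) _.
  by rewrite /GRing.scale /= expr1 mulr1.
have dV := @is_deriveV R (fun z => (z - r) ^+ 2) x _ 1 (expf_neq0 2 xr0) dt2.
have dE : is_derive x (1 : R) (expR \o G) (expR (G x) * g).
  exact: is_derive1_comp.
have dr := is_deriveM dV dE.
apply: trigger_derive (is_deriveM dr (is_derive_poly A x)) _.
rewrite /= -gAB /rho -[(x - r) ^ (- 2)]/((x - r) ^+ 2)^-1 /GRing.scale /=.
rewrite -[(_ * (expR \o G)) x]/((x - r) ^- 2 * expR (G x)).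
by field.
Qed.

Lemma rho_double_poleE {R : realType} (r : R) (G : R -> R) (x : R) :
  rho r (- 2) G x = (x - r) ^- 2 * expR (G x).
Proof. by []. Qed.

Lemma rho_gt0 {R : realType} (r : R) (G : R -> R) (x : R) :
  x != r -> 0 < rho r (- 2) G x.
Proof.
move=> xr; rewrite rho_double_poleE mulr_gt0 ?expR_gt0 // invr_gt0.
by rewrite exprn_even_gt0 //= subr_eq0.
Qed.

(** Even at x = r, where both sides are 0 because 0^-1 = 0. *)
Lemma omega_double_poleE {R : realType} (r : R) (G : R -> R) (x : R) :
  omega r (- 2) G x * (x - r) = rho r (- 2) G x.
Proof.
rewrite /omega; have [->|xr] := eqVneq x r; last by rewrite divfK ?subr_eq0.
by rewrite rho_double_poleE subrr mulr0 expr0n invr0 mul0r.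
Qed.

Theorem corollary3p2 (R : realType) (a2 a1 a0 b2 b1 b0 r c nu : R)
    (k : int) (a b : \bar R) (G : R -> R) (y : nat -> {poly R})
    (hAr : a2 * r ^+ 2 + a1 * r + a0 != 0)
    (hB : real_roots (quad b2 b1 b0))
    (hc1 : 2 * b2 * r + b1 - c + nu * b2 = 0)
    (hc2 : b2 * r ^+ 2 + b1 * r + b0 + nu * c = 0)
    (htheta : theta a2 a1 a0 b2 b1 b0 r = k%:~R)
    (hsign : (-1 : R) ^ k = 1)
    (hab : (a < b)%E)
    (hA : forall x : R, oitv a b x -> (quad a2 a1 a0).[x] != 0)
    (hG : antiderivative_on (oitv a b)
            (exponent_integrand a2 a1 a0 b2 b1 b0 r) G)
    (ha : omega r k G x * (x - r) * (quad a2 a1 a0).[x]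
            @[x --> to_left_end a] --> (0 : R))
    (hb : omega r k G x * (x - r) * (quad a2 a1 a0).[x]
            @[x --> to_right_end b] --> (0 : R))
    (hy : eigenfunctions a2 a1 a0 b2 b1 b0 r c nu y)
    (hint : forall n m : nat, (0 < n)%N -> (0 < m)%N ->
       (@lebesgue_measure R).-integrable (oitv a b)
         (fun x : R => (rho r k G x * (y n).[x] * (y m).[x])%:E)) :
  [/\ exceptional_X1 r nu y,
      forall x : R, oitv a b x -> x != r -> 0 < rho r k G x
    & orthogonal_on (oitv a b) (rho r k G) y].
Proof.
pose A := quad a2 a1 a0; pose B := quad b2 b1 b0; pose D := oitv a b.
pose l := Defs.eigenvalue a2 b2.
have AE x : A.[x] = a2 * x ^+ 2 + a1 * x + a0 by rewrite /A /quad !hornerE.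
have BE x : B.[x] = b2 * x ^+ 2 + b1 * x + b0 by rewrite /B /quad !hornerE.
have dAE x : A^`().[x] = 2 * a2 * x + a1.
  by rewrite /A /quad expr2 !derivEs !hornerE /=; ring.
have Ar0 : A.[r] != 0 by rewrite AE.
have hyPi n : (0 < n)%N -> size (y n) = n.+1 /\ Pi_form r nu (y n) = 0.
  by move=> n0; have [sy /(in_PiE _ _ _ _ n0)[_ ?] _] := hy n n0.
have hode n : (0 < n)%N ->
    ode_op A B r c (y n) = l n *: (('X - r%:P) * y n).
  move=> n0; have [_ _ e] := hy n n0; rewrite /ode_op -!mul_polyC.
  apply/eqP; rewrite -subr_eq0 -[X in _ == X]e -!mul_polyC; apply/eqP.
  by rewrite -/A -/B -/(l n); ring.
have Bnu : B.[r] + nu * c = 0 by rewrite BE.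
have [nu0 BAr] := coef_ratio_at_singularity _ _ _ _ _ _ _ Ar0 Bnu hyPi hode.
have th2 : theta a2 a1 a0 b2 b1 b0 r = - 2.
  by rewrite /theta -/A -/B BAr mulfK.
have k2 : k = - 2.
  by apply: (@intr_inj R); rewrite -htheta th2 mulrNz.
subst k.
have intPi p q : Pi_form r nu p = 0 -> Pi_form r nu q = 0 ->
    (@lebesgue_measure R).-integrable D
      (EFin \o (fun x => rho r (- 2) G x * p.[x] * q.[x])).
  by apply: integrable_Pi hint => //; exact: oitv_measurable.
(* rho (x - r - nu)^2 is integrable and would have a double pole at r. *)
have Dr x : D x -> x != r.
  move=> Dx; apply/eqP => xr; move: Dx; rewrite xr => {x xr} Dr.
  have L0 : Pi_form r nu ('X - (r + nu)%:P) = 0.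
    by rewrite /Pi_form !derivEs !hornerE /=; ring.
  have cG : {for r, continuous G}.
    have [dG _] := hG r Dr; apply/differentiable_continuous.
    exact/derivable1_diffP.
  pose h x := expR (G x) * ('X - (r + nu)%:P).[x] ^+ 2.
  have ch : {for r, continuous h}.
    apply: cvgM; first by apply: continuous_comp => //; exact: continuous_expR.
    by apply: cvgM; exact: continuous_horner.
  apply: (double_pole_not_integrable D r h (oitv_open a b)
    (oitv_measurable a b) Dr ch).
    rewrite /h mulr_gt0 ?expR_gt0 // exprn_even_gt0 //= !hornerE /=.
    by rewrite opprD addrA subrr sub0r oppr_eq0.
  have mD := oitv_measurable a b.
  apply: eq_integrableR (intPi _ _ L0 L0) => // x _ /=.
  by rewrite rho_double_poleE /h expr2 !mulrA.
split.
- exact: exceptional_of_Pi_form hyPi.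
- by move=> x _; exact: rho_gt0.
move=> n m n0 m0 mn; rewrite -/D.
pose W := wronskian (y n) (y m).
pose F x := rho r (- 2) G x * A.[x] * W.[x].
pose q := (l n - l m) *: (y n * y m).
pose f x := rho r (- 2) G x * q.[x].
(* theta = -2 turns the exponent integrand into the one for which rho A is the
   integrating factor. *)
have dP x : D x -> is_derive x (1 : R) (fun z => rho r (- 2) G z * A.[z])
    (rho r (- 2) G x * B.[x] / (x - r)).
  move=> Dx; apply: (is_derive_rho _ _ _ _ _ _ (Dr x Dx) (hG x Dx)).
  rewrite /exponent_integrand th2 divfK; last exact: hA.
  have b0E : b0 = - 2 * (a2 * r ^+ 2 + a1 * r + a0) - b2 * r ^+ 2 - b1 * r.
    by rewrite -AE -BAr BE; ring.
  by rewrite dAE AE BE b0E; ring.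
have Wode := wronskian_eigen_at _ _ _ _ _ _ _ _ (hode n n0) (hode m m0).
have dF x : D x -> is_derive x (1 : R) F (f x).
  move=> Dx; have t0 : x - r != 0 by rewrite subr_eq0 Dr.
  have dPx := dP x Dx.
  apply: trigger_derive (is_deriveM dPx (is_derive_poly W x)) _.
  have qE : q.[x] = (l n - l m) * ((y n).[x] * (y m).[x]).
    by rewrite /q hornerZ hornerM.
  rewrite /f qE; apply: (mulfI t0).
  transitivity (rho r (- 2) G x *
    (B.[x] * W.[x] + (x - r) * A.[x] * W^`().[x])).
    by rewrite /GRing.scale /=; field.
  by rewrite Wode; ring.
(* f is rho times the polynomial q, hence differentiable; B is here the constant
   polynomial with the value that fits the relation at x. *)
have cf x : D x -> {for x, continuous f}.
  move=> Dx; have dG := hG x Dx.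
  pose g := exponent_integrand a2 a1 a0 b2 b1 b0 r x.
  have [df _] := is_derive_rho q
    ((x - r) * (g * q.[x] + q^`().[x]) - 2 * q.[x])%:P r x g G (Dr x Dx) dG
    (esym (hornerC _ _)).
  by apply/differentiable_continuous/derivable1_diffP.
have mD := oitv_measurable a b.
have intF : (@lebesgue_measure R).-integrable D (EFin \o
    (fun z => (z - r) ^+ 4 * (rho r (- 2) G z * A.[z] * W.[z]))).
  have L1 := Pi_form_multiple r nu (A * W).
  have L2 := Pi_form_multiple r nu 1.
  apply: eq_integrableR (intPi _ _ L1 L2) => // x _ /=.
  rewrite hornerM (hornerM A W) mulr1 horner_exp hornerXsubC.
  by congr EFin; ring.
have cW : continuous (horner W) by exact: continuous_horner.
have smallr := small_toward_right_end a b r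
  (fun z => rho r (- 2) G z * A.[z]) (horner W) cW _ intF.
have smalll := small_toward_left_end a b r
  (fun z => rho r (- 2) G z * A.[z]) (horner W) cW _ intF.
have omE : (fun x => omega r (- 2) G x * (x - r) * A.[x]) =
    (fun x => rho r (- 2) G x * A.[x]).
  by apply/funext => x; rewrite omega_double_poleE.
rewrite -/A omE in ha hb.
move: (smallr hb) (smalll ha) => {}smallr {}smalll.
have fE x : f x = (l n - l m) * (rho r (- 2) G x * (y n).[x] * (y m).[x]).
  by rewrite /f /q hornerZ hornerM; ring.
have intf : (@lebesgue_measure R).-integrable D (EFin \o f).
  have := integrableZl (mu := @lebesgue_measure R) mD (l n - l m)
    (hint n m n0 m0).
  apply: eq_integrableR => // x _ /=.
  by rewrite fE.
have := integral_derivative_eq0 a b F f hab dF cf intf smallr smalll.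
have [lnm|lnm] := eqVneq (l n) (l m); last first.
  under eq_integral do rewrite fE EFinM.
  rewrite integralZl //; last exact: hint.
  move=> /eqP; rewrite mule_eq0 eqe subr_eq0 (negbTE lnm) /=.
  by move=> /eqP.
(* Equal eigenvalues: rho A W would be constant, hence zero. *)
move=> _; exfalso.
have F0 : forall x, D x -> F x = 0.
  apply: zero_derivative_small_eq0 smallr => x Dx.
  by apply: trigger_derive (dF x Dx) _; rewrite fE lnm subrr mul0r.
have [x0 Dx0] := oitv_nonempty _ _ hab.
have [x1 [Dx1 x01 _]] := smallr _ _ ltr01 Dx0.
have [syn _] := hyPi n n0; have [sym _] := hyPi m m0.
have /eqP : W != 0.
  apply: wronskian_neq0; rewrite -?size_poly_eq0 ?syn ?sym // => -[] /esym.
  exact: mn.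
apply.
apply: (polynomial_eq0_on_itv _ _ _ x01) => t /andP[/ltW x0t /ltW tx1].
have Dt : D t by apply: (oitv_convex _ _ _ _ _ Dx0 Dx1); rewrite x0t.
have /eqP := F0 t Dt; rewrite /F mulf_eq0 mulf_eq0 (negbTE (hA t Dt)).
by rewrite gt_eqF ?rho_gt0 ?Dr //= => /eqP.
Qed.
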